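(* (a) Let $f,g\in\mathbb Z[t]$ be monic polynomials with $\mathrm{Res}(f,g)\neq 0$ (equivalently, $\gcd(f,g)_{\mathbb Q[t]}=1$). Then $$H^{[fg]}\cong H^{[f]}\oplus H^{[g]}\iff|\mathrm{Res}(f,g)|=1.$$ (b) Let $f_1,f_2,f_3,f_4\in\mathbb Z[t]$ be monic polynomials with $\mathrm{Res}(f_i,f_j)\neq 0$ for all $i\neq j$. Then $$H^{[f_1f_3f_4]}\oplus H^{[f_2f_3]}\cong H^{[f_1f_3]}\oplus H^{[f_2f_3f_4]}\iff|\mathrm{Res}(f_1,f_4)|=|\mathrm{Res}(f_2,f_4)|=1.$$
   Context: For a monic polynomial $p\in\mathbb Z[t]$ of degree $\geq 0$, $H^{[p]}:=\mathbb Z[t]/p\mathbb Z[t]$ together with the endomorphism $h_{[p]}:H^{[p]}\to H^{[p]}$ given by multiplication by $t$ (so $H^{[1]}=0$). A direct sum carries the direct sum of the endomorphisms, and $\cong$ means isomorphism of $\mathbb Z$-lattices compatible with the endomorphisms, i.e. isomorphism of $\mathbb Z[t]$-modules. $\mathrm{Res}(f,g)$ is the resultant; for monic $f=\prod_{i=1}^m(t-a_i)$ and $g=\prod_{j=1}^n(t-b_j)$ over $\mathbb C$ one has $|\mathrm{Res}(f,g)|=\prod_{i,j}|a_i-b_j|$ (equal to $1$ if $f=1$ or $g=1$). *)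

(* Defs.v *)
From HB Require Import structures.
From mathcomp Require Import all_boot all_order all_algebra.
From mathcomp Require Import boolp.

Set Implicit Arguments.
Unset Strict Implicit.
Unset Printing Implicit Defensive.

Import GRing.Theory.
Local Open Scope ring_scope.
Local Open Scope quotient_scope.

(* An abelian group with an endomorphism, i.e. a Z[t]-module with t acting as
   [endo].  Freeness and finite generation are not recorded: H^[p] has them
   for monic p, and isomorphisms do not involve them. *)
Record endoZmod := EndoZmod {
  carrier :> zmodType;
  endo : {additive carrier -> carrier} }.

Definition endo_iso (A B : endoZmod) : Prop :=
  exists phi : {additive A -> B},
    bijective phi /\ (forall x : A, phi (endo A x) = endo B (phi x)).

Notation "A ≅ B" := (endo_iso A B) (at level 70, no associativity).

Section DirectSum.
Variables A B : endoZmod.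

Definition sum_endo (x : (carrier A * carrier B)%type) :
    (carrier A * carrier B)%type :=
  (endo A x.1, endo B x.2).

Fact sum_endo_is_zmod_morphism : zmod_morphism sum_endo.
Proof. by move=> x y; rewrite /sum_endo /= !raddfB. Qed.

HB.instance Definition _ :=
  GRing.isZmodMorphism.Build (carrier A * carrier B)%type
    (carrier A * carrier B)%type sum_endo sum_endo_is_zmod_morphism.

Definition endo_sum : endoZmod :=
  @EndoZmod (carrier A * carrier B)%type sum_endo.

End DirectSum.

Notation "A ⊕ B" := (endo_sum A B) (at level 50, left associativity).

Section PrincipalQuotient.
Variable p : {poly int}.

(* [{ideal_quot _}] takes a boolean predicate, hence the classical truth value
   [`[< _ >]].  The ideal is only declared closed under subtraction, not as an
   [idealr]: that would exclude the unit ideal, needed for p = 1. *)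
Definition principal_ideal : {poly int} -> bool :=
  fun q => `[< exists r : {poly int}, q = p * r >].

Fact principal_ideal_zmod_closed : zmod_closed principal_ideal.
Proof.
split=> [|u v /asboolP[a ->] /asboolP[b ->]]; apply/asboolP.
  by exists 0; rewrite mulr0.
by exists (a - b); rewrite mulrBr.
Qed.

HB.instance Definition _ :=
  GRing.isZmodClosed.Build {poly int} principal_ideal
    principal_ideal_zmod_closed.

Local Notation pideal := (GRing.ZmodClosed.clone {poly int} principal_ideal _).

Definition Hquot : zmodType := {ideal_quot pideal}.

Definition mulX (x : Hquot) : Hquot :=
  \pi_({ideal_quot pideal}) ('X * repr x).

Fact mulX_pi (q : {poly int}) :
  mulX (\pi_({ideal_quot pideal}) q) =
  \pi_({ideal_quot pideal}) ('X * q).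
Proof.
apply/eqP; rewrite /mulX -Quotient.idealrBE -mulrBr.
have: repr (\pi_({ideal_quot pideal}) q) - q \in principal_ideal.
  by rewrite Quotient.idealrBE reprK.
case/asboolP=> r ->; apply/asboolP; exists ('X * r).
by rewrite mulrCA.
Qed.

Fact mulX_is_zmod_morphism : zmod_morphism mulX.
Proof.
move=> x y; rewrite -[x](@reprK _ {ideal_quot pideal}).
rewrite -[y](@reprK _ {ideal_quot pideal}) -raddfB !mulX_pi.
by rewrite mulrBr raddfB.
Qed.

HB.instance Definition _ :=
  GRing.isZmodMorphism.Build Hquot Hquot mulX mulX_is_zmod_morphism.

Definition Hmod : endoZmod := @EndoZmod Hquot mulX.

End PrincipalQuotient.

Notation "''H[' p ]" := (Hmod p) (at level 0, p at level 200, format "''H[' p ]").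

(* Main.v *)
Require Import Defs.
From HB Require Import structures.
From mathcomp Require Import all_boot all_order all_algebra.
From mathcomp Require Import ring boolp.

Set Implicit Arguments.
Unset Strict Implicit.
Unset Printing Implicit Defensive.

Import GRing.Theory.
Local Open Scope ring_scope.

(** For monic [f] and [g], [|Res(f, g)| = 1] holds exactly when [f] and [g] are
    comaximal in Z[t]: the resultant lies in the ideal [(f, g)], and conversely
    a Bezout relation makes the Sylvester matrix invertible over Z.  So both
    parts are about comaximality in Z[t].

    The module [H^[p] + H^[q]] is the cokernel of the diagonal matrix
    [diag(p, q)] over Z[t].  Hence the isomorphism of part (b) exists as soon as
    [diag(f1 f4, f2)] and [diag(f1, f2 f4)] are equivalent over Z[t] (the common
    factor [f3] only rescales both).  When [f4] is comaximal to [f1] and to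
    [f2], it is comaximal to [f1 f2], and a relation
    [f4 d0 - f1 f2 b0 = 1] gives an explicit equivalence of determinant one.

    Conversely, the first Fitting ideal of that cokernel is [(p, q)], so an
    isomorphism forces [(f1 f3 f4, f2 f3) = (f1 f3, f2 f3 f4)].  Cancelling [f3]
    puts [f1] in [(f1 f4, f2)]; since [f1] is a nonzerodivisor modulo [f2], this
    says that 1 lies in [(f4, f2)].  The other comaximality is symmetric.  The
    invariance of the Fitting ideal is proved by hand for 2 by 2 matrices
    ([Fitting_ideal_mono]).

    Part (a) is part (b) with [f1 = f], [f4 = g] and [f2 = f3 = 1], because
    [H^[1] = 0]. *)

(** * Resultants and comaximality *)

Section Resultant.
Variable R : comNzRingType.
Implicit Types f g h : {poly R}.

Definition comaximal f g := exists u v : {poly R}, u * f + v * g = 1.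

(** A constant monic polynomial is 1 and generates the unit ideal, so the
    degree conditions of [resultant_in_ideal] can be dropped. *)
Lemma resultant_in_ideal_monic f g : f \is monic -> g \is monic ->
  exists u v : {poly R}, (resultant f g)%:P = u * f + v * g.
Proof.
have nonconst (h : {poly R}) : h \is monic -> h = 1 \/ (1 < size h)%N.
  move=> hM; have : (0 < size h)%N by rewrite size_poly_gt0 monic_neq0.
  rewrite leq_eqVlt => /predU1P[sh|]; last by right.
  left; move/esym/eqP: sh => /size_poly1P[c _ hE].
  by move: hM; rewrite hE monicE lead_coefC => /eqP ->.
move=> /nonconst[-> _|sf /nonconst[->|sg]].
- by exists (resultant 1 g)%:P, 0; ring.
- by exists 0, (resultant f 1)%:P; ring.
by have [[u v] _ E] := resultant_in_ideal sf sg; exists u, v.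
Qed.

(** Multiply the Bezout relation by [h] and reduce the first coefficient modulo
    the monic [g]; the degree of the second is then forced. *)
Lemma comaximal_bounded f g h : f \is monic -> g \is monic ->
  comaximal f g -> (size h <= (size g).-1 + (size f).-1)%N ->
  exists a b : {poly R}, [/\ (size a <= (size g).-1)%N,
     (size b <= (size f).-1)%N & h = a * f + b * g].
Proof.
move=> fM gM [u [v uv]] hS.
pose q := Pdiv.Ring.rdivp (h * u) g; pose a := Pdiv.Ring.rmodp (h * u) g.
have huE : h * u = q * g + a by exact: Pdiv.RingMonic.rdivp_eq.
have f0 : (0 < size f)%N by rewrite size_poly_gt0 monic_neq0.
have g0 : (0 < size g)%N by rewrite size_poly_gt0 monic_neq0.
have sa : (size a <= (size g).-1)%N.
  by rewrite -ltnS prednK // Pdiv.Ring.ltn_rmodpN0 // monic_neq0.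
pose b := q * f + h * v.
have hE : h = a * f + b * g.
  transitivity (h * (u * f + v * g)); first by rewrite uv mulr1.
  by rewrite mulrDr mulrA huE /b; ring.
exists a, b; split=> //.
have [->|b0] := eqVneq b 0; first by rewrite size_poly0.
have saf : (size (a * f)%R <= (size g).-1 + (size f).-1)%N.
  apply: leq_trans (size_polyMleq _ _) _.
  by case: (size f) f0 => //= n _; rewrite addnS /= leq_add2r.
have : (size (b * g)%R <= (size g).-1 + (size f).-1)%N.
  have -> : b * g = h - a * f by rewrite {1}hE; ring.
  by apply: leq_trans (size_polyD _ _) _; rewrite size_polyN geq_max hS.
rewrite size_Mmonic //; case: (size g) g0 => //= n _.
by rewrite addnS /= addnC leq_add2l.
Qed.

End Resultant.

(** By [comaximal_bounded] the Sylvester matrix reaches every row vector, so it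
    has a left inverse over [R] and its determinant is a unit. *)
Lemma comaximal_resultant_unit (R : comUnitRingType) (f g : {poly R}) :
  f \is monic -> g \is monic ->
  comaximal f g -> resultant f g \is a GRing.unit.
Proof.
move=> fM gM fg.
have onto (i : 'I_((size g).-1 + (size f).-1)) :
    exists c, c *m Sylvester_mx f g = row i 1%:M.
  pose h := rVpoly (row i (1%:M : 'M[R]_((size g).-1 + (size f).-1))).
  have [a [b [sa sb hE]]] := comaximal_bounded fM gM fg (size_poly _ _ : size h <= _)%N.
  exists (row_mx (poly_rV a) (poly_rV b)).
  rewrite /Sylvester_mx mul_row_col !mul_rV_lin1 /= !poly_rV_K // -raddfD /=.
  by rewrite -[a * f + _]hE rVpolyK.
have [C CE] := fin_all_exists onto.
have CS : (\matrix_i C i) *m Sylvester_mx f g = 1%:M.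
  by apply/row_matrixP=> i; rewrite row_mul rowK CE.
by have [_] := mulmx1_unit CS; rewrite unitmxE.
Qed.

Lemma comaximal_resultant1 (f g : {poly int}) : f \is monic -> g \is monic ->
  comaximal f g <-> `|resultant f g| = 1.
Proof.
move=> fM gM; split=> [fg|r1].
  by have /orP[] := comaximal_resultant_unit fM gM fg => /eqP ->.
have [u [v uvE]] := resultant_in_ideal_monic fM gM.
exists ((Num.sg (resultant f g))%:P * u), ((Num.sg (resultant f g))%:P * v).
by rewrite -!mulrA -mulrDr -uvE -polyCM -Num.Theory.normrEsg r1.
Qed.

(** As [Res(f, g)] lies in [(f, g)], [g] divides the multiple [Res(f, g) *: x];
    a nonzero integer factor can be cancelled because remainders modulo the
    monic [g] are torsion-free. *)
Lemma divides_of_resultant_neq0 (f g x y : {poly int}) :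
  f \is monic -> g \is monic -> resultant f g != 0 ->
  f * x = g * y -> exists z, x = z * g.
Proof.
move=> fM gM r0 E; have [u [v uv]] := resultant_in_ideal_monic fM gM.
have /(congr1 (fun h => Pdiv.Ring.rmodp h g)) :
    resultant f g *: x = (u * y + v * x) * g.
  by rewrite -mul_polyC uv mulrDl -[u * f * x]mulrA E; ring.
rewrite /= Pdiv.RingMonic.rmodpZ // Pdiv.RingMonic.rmodp_mull // => /eqP.
rewrite -mul_polyC mulf_eq0 polyC_eq0 (negbTE r0) /= => /(Pdiv.RingMonic.rdvdpP gM)[z ->].
by exists z.
Qed.

(** The hypothesis reads [f (1 - h u) = g v], and [f] is a nonzerodivisor modulo
    [g]. *)
Lemma comaximal_of_absorb (f g h u v : {poly int}) :
  f \is monic -> g \is monic -> resultant f g != 0 ->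
  f = f * h * u + g * v -> comaximal g h.
Proof.
move=> fM gM r0 E.
have [//|//|//||z zE] := @divides_of_resultant_neq0 f g (1 - h * u) v.
  by rewrite mulrBr mulr1 {1}E; ring.
by exists z, u; rewrite -zE; ring.
Qed.

(** * Classes modulo p and isomorphisms *)

Definition cls (p x : {poly int}) : 'H[p] :=
  \pi_({ideal_quot GRing.ZmodClosed.clone {poly int} (principal_ideal p) _})%qT x.

Lemma clsB p : zmod_morphism (cls p).
Proof. by move=> x y; rewrite /cls raddfB. Qed.

HB.instance Definition _ p :=
  GRing.isZmodMorphism.Build {poly int} 'H[p] (cls p) (@clsB p).

Lemma cls_eq p x y : cls p x = cls p y <-> exists r, x - y = p * r.
Proof.
split=> [/eqP|h]; last apply/eqP; rewrite -Quotient.idealrBE.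
  by case/asboolP=> r ->; exists r.
by apply/asboolP.
Qed.

Lemma cls_eq0 p x : cls p x = 0 <-> exists r, x = p * r.
Proof. by rewrite -(raddf0 (cls p)) cls_eq subr0. Qed.

Lemma cls_surj p (z : 'H[p]) : exists x, z = cls p x.
Proof. by exists (repr z); rewrite /cls reprK. Qed.

Lemma endo_cls p x : endo 'H[p] (cls p x) = cls p ('X * x).
Proof. exact: mulX_pi. Qed.

Lemma endo_iso_sym A B : A ≅ B -> B ≅ A.
Proof.
move=> [phi [[psi phiK psiK] phiE]].
pose psiM := GRing.isZmodMorphism.Build _ _ psi (can2_zmod_morphism phiK psiK).
pose psi' : {additive B -> A} := HB.pack psi psiM.
exists psi'; split; first by exists phi.
by move=> y /=; apply: (can_inj phiK); rewrite phiE !psiK.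
Qed.

Lemma endo_iso_trans A B C : A ≅ B -> B ≅ C -> A ≅ C.
Proof.
move=> [phi [phi_bij phiE]] [psi [psi_bij psiE]].
exists (psi \o phi); split; first exact: bij_comp.
by move=> x /=; rewrite phiE psiE.
Qed.

Lemma endo_sumC A B : A ⊕ B ≅ B ⊕ A.
Proof.
pose phi (z : A ⊕ B) : B ⊕ A := (z.2, z.1).
have phiB : zmod_morphism phi by move=> x y; congr pair.
pose phi' : {additive A ⊕ B -> B ⊕ A} :=
  HB.pack phi (GRing.isZmodMorphism.Build _ _ phi phiB).
by exists phi'; split=> //; exists (fun z => (z.2, z.1)) => -[].
Qed.

Lemma endo_iso_sum0 A : A ≅ A ⊕ 'H[1].
Proof.
pose phi (x : A) : A ⊕ 'H[1] := (x, 0).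
have phiM : zmod_morphism phi by move=> x y; congr pair; rewrite subr0.
pose phi' : {additive A -> A ⊕ 'H[1]} :=
  HB.pack phi (GRing.isZmodMorphism.Build _ _ phi phiM).
exists phi'; split.
  exists fst => // -[x z] /=; congr pair.
  by have [y ->] := cls_surj z; apply/esym/cls_eq0; exists y; rewrite mul1r.
by move=> x; congr pair; rewrite /= raddf0.
Qed.

(** * Matrices of homomorphisms *)

(** Z[t] is free of rank one over itself: an equivariant map is determined by
    the image [cls r a] of 1. *)
Lemma equivariant_cls (r : {poly int}) (F : {poly int} -> 'H[r]) :
  zmod_morphism F -> (forall x, F ('X * x) = endo 'H[r] (F x)) ->
  exists a, forall x, F x = cls r (a * x).
Proof.
move=> FB FX.
pose F' : {additive {poly int} -> 'H[r]} :=
  HB.pack F (GRing.isZmodMorphism.Build _ _ F FB).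
have FD x y : F (x + y) = F x + F y by exact: (raddfD F').
have [a aE] := cls_surj (F 1); exists a; elim/poly_ind=> [|x c IH].
  by rewrite mulr0 raddf0; exact: (raddf0 F').
have cE : c%:P = 1 *~ c :> {poly int} by rewrite -[in LHS](intz c) rmorph_int.
have Fc : F (c%:P) = cls r (a * c%:P).
  by rewrite cE -[LHS]/(F' _) raddfMz /= aE -raddfMz mulrzr.
by rewrite FD mulrC FX IH Fc endo_cls -raddfD; congr cls; ring.
Qed.

Lemma hom_matrix p q r s (phi : {additive 'H[p] ⊕ 'H[q] -> 'H[r] ⊕ 'H[s]}) :
  (forall x, phi (endo _ x) = endo _ (phi x)) ->
  exists a b c d, forall x y,
    phi (cls p x, cls q y) = (cls r (a * x + b * y), cls s (c * x + d * y)).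
Proof.
move=> phiE.
have EE (A B : endoZmod) (x : A ⊕ B) : endo _ x = (endo _ x.1, endo _ x.2).
  by [].
have row_of t (pr : {additive 'H[r] ⊕ 'H[s] -> 'H[t]}) :
    (forall z, pr (endo _ z) = endo _ (pr z)) ->
    exists a b, forall x y, pr (phi (cls p x, cls q y)) = cls t (a * x + b * y).
  move=> prE.
  have [||a /= aE] := @equivariant_cls t (fun x => pr (phi (cls p x, 0))).
  - move=> x y; rewrite -!raddfB; congr (pr (phi _)); congr pair.
      by rewrite raddfB.
    by rewrite subr0.
  - by move=> x; rewrite -prE -phiE EE /= endo_cls raddf0.
  have [||b /= bE] := @equivariant_cls t (fun x => pr (phi (0, cls q x))).
  - move=> x y; rewrite -!raddfB; congr (pr (phi _)); congr pair.
      by rewrite subr0.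
    by rewrite raddfB.
  - by move=> x; rewrite -prE -phiE EE /= endo_cls raddf0.
  exists a, b => x y; rewrite raddfD /= -aE -bE -!raddfD.
  by congr (pr (phi _)); congr pair; rewrite /= ?addr0 ?add0r.
have [//|a [b abE]] := row_of r fst.
have [//|c [d cdE]] := row_of s snd.
exists a, b, c, d => x y.
by rewrite -abE -cdE -surjective_pairing.
Qed.

(** The divisibility conditions say that the matrix carries the column space of
    [diag(p, q)] into that of [diag(r, s)]. *)
Lemma matrix_hom p q r s a b c d :
  (exists k, a * p = r * k) -> (exists k, b * q = r * k) ->
  (exists k, c * p = s * k) -> (exists k, d * q = s * k) ->
  exists2 phi : {additive 'H[p] ⊕ 'H[q] -> 'H[r] ⊕ 'H[s]},
    (forall x, phi (endo _ x) = endo _ (phi x)) &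
    forall x y,
      phi (cls p x, cls q y) = (cls r (a * x + b * y), cls s (c * x + d * y)).
Proof.
move=> ap bq cp dq.
pose phi (z : 'H[p] ⊕ 'H[q]) : 'H[r] ⊕ 'H[s] :=
  (cls r (a * repr z.1 + b * repr z.2), cls s (c * repr z.1 + d * repr z.2)).
have row_cls t u v x y :
    (exists k, u * p = t * k) -> (exists k, v * q = t * k) ->
    cls t (u * repr (cls p x) + v * repr (cls q y)) = cls t (u * x + v * y).
  move=> [k kE] [l lE].
  have /cls_eq[m mE] : cls p (repr (cls p x)) = cls p x by rewrite /cls reprK.
  have /cls_eq[n nE] : cls q (repr (cls q y)) = cls q y by rewrite /cls reprK.
  apply/cls_eq; exists (k * m + l * n).
  by rewrite opprD addrACA -!mulrBr mE nE mulrDr !mulrA kE lE.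
have phi_cls x y :
    phi (cls p x, cls q y) = (cls r (a * x + b * y), cls s (c * x + d * y)).
  by congr pair; apply: row_cls.
have pair_cls (z : 'H[p] ⊕ 'H[q]) : exists x y, z = (cls p x, cls q y).
  case: z => z1 z2; have [x ->] := cls_surj z1; have [y ->] := cls_surj z2.
  by exists x, y.
have phiB : zmod_morphism phi.
  move=> z z'; have [x [y ->]] := pair_cls z; have [x' [y' ->]] := pair_cls z'.
  rewrite -[LHS]/(phi (cls p x - cls p x', cls q y - cls q y')) -!clsB !phi_cls.
  by congr pair; rewrite -clsB; congr cls; ring.
pose phi' : {additive 'H[p] ⊕ 'H[q] -> 'H[r] ⊕ 'H[s]} :=
  HB.pack phi (GRing.isZmodMorphism.Build _ _ phi phiB).
exists phi' => // z; have [x [y ->]] := pair_cls z.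
rewrite -[LHS]/(phi (endo _ (cls p x), endo _ (cls q y))).
rewrite -[RHS]/(endo _ (phi _).1, endo _ (phi _).2) (endo_cls p) (endo_cls q) !phi_cls.
by congr pair; rewrite [RHS]endo_cls; congr cls; ring.
Qed.

(** * The Fitting ideal *)

(** Modulo [I = (p, q)] the matrices [N] of [psi] and [M] of [phi] satisfy
    [N M = 1], hence [det N det M = 1].  Since [psi] kills the relation [r] of
    the first summand, the first column of [N] multiplied by [r] vanishes
    modulo [I], so [r det N] lies in [I] and therefore so does [r]. *)
Lemma Fitting_ideal_mono p q r s :
  'H[p] ⊕ 'H[q] ≅ 'H[r] ⊕ 'H[s] -> exists u v, r = p * u + q * v.
Proof.
move=> [phi [[psi phiK psiK] phiE]].
have psiE y : psi (endo _ y) = endo _ (psi y).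
  by apply: (can_inj phiK); rewrite phiE !psiK.
pose psi' : {additive 'H[r] ⊕ 'H[s] -> 'H[p] ⊕ 'H[q]} :=
  HB.pack psi (GRing.isZmodMorphism.Build _ _ psi (can2_zmod_morphism phiK psiK)).
have [a [b [c [d phi_cls]]]] := hom_matrix phiE.
have [a' [b' [c' [d' psi_cls]]]] := @hom_matrix _ _ _ _ psi' psiE.
have comp x y : [/\ exists k, a' * (a * x + b * y) + b' * (c * x + d * y) - x = p * k
  & exists k, c' * (a * x + b * y) + d' * (c * x + d * y) - y = q * k].
  have /= := phiK (cls p x, cls q y).
  rewrite phi_cls -[psi _]/(psi' _) psi_cls => -[].
  by move=> /cls_eq ? /cls_eq ?.
have [[k11 e11] [k21 e21]] := comp 1 0.
have [[k12 e12] [k22 e22]] := comp 0 1.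
have [[l1 m1] [l2 m2]] : (exists k, a' * r = p * k) /\ (exists k, c' * r = q * k).
  have := psi_cls r 0.
  have -> : (cls r r, cls s 0) = 0 :> 'H[r] ⊕ 'H[s].
    by congr pair; [apply/cls_eq0; exists 1; rewrite mulr1 | rewrite raddf0].
  rewrite raddf0 !mulr0 !addr0 => -[/esym/cls_eq0 ? /esym/cls_eq0 ?].
  by [].
(* Multiplicativity of the determinant, before reduction modulo (p, q). *)
pose det := a * d - b * c.
have detE : (a' * a + b' * c) * (c' * b + d' * d)
   - (c' * a + d' * c) * (a' * b + b' * d) = (a' * d' - b' * c') * det.
  by rewrite /det; ring.
move: e11 e21 e12 e22; rewrite !mulr0 !mulr1 !addr0 !add0r !subr0.
move=> /(canRL (subrK _)) e11 e21 e12 /(canRL (subrK _)) e22.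
rewrite e11 e21 e12 e22 in detE.
have rE : r = (a' * r * d' - b' * (c' * r)) * det
    - r * (p * k11 + q * k22 + p * k11 * (q * k22) - q * k21 * (p * k12)).
  have -> : (a' * r * d' - b' * (c' * r)) * det = r * ((a' * d' - b' * c') * det).
    by ring.
  by rewrite -detE; ring.
exists (l1 * d' * det - r * (k11 + k11 * (q * k22) - q * k21 * k12)),
       (- (b' * l2 * det) - r * k22).
by rewrite {1}rE m1 m2; ring.
Qed.

(** * The criterion *)

Lemma endo_iso_comaximal f1 f2 f3 f4 :
  f1 \is monic -> f2 \is monic -> f3 \is monic ->
  resultant f1 f2 != 0 -> resultant f2 f1 != 0 ->
  'H[f1 * f3 * f4] ⊕ 'H[f2 * f3] ≅ 'H[f1 * f3] ⊕ 'H[f2 * f3 * f4] <->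
  comaximal f1 f4 /\ comaximal f2 f4.
Proof.
move=> f1M f2M f3M r12 r21; have f3I := mulfI (monic_neq0 f3M).
split=> [iso|[[u1 [v1 e1]] [u2 [v2 e2]]]].
  split; last first.
    have [u [v E]] := Fitting_ideal_mono iso.
    apply: (@comaximal_of_absorb f1 f2 f4 u v) => //.
    by apply: f3I; rewrite [LHS]mulrC E; ring.
  have := endo_iso_trans (endo_iso_sym iso) (endo_sumC _ _).
  move=> /(endo_iso_trans (endo_sumC _ _)) /Fitting_ideal_mono[u [v E]].
  apply: (@comaximal_of_absorb f2 f1 f4 u v) => //.
  by apply: f3I; rewrite [LHS]mulrC E; ring.
(* Product of the two Bezout relations. *)
have [b0 [d0 bd]] : exists b0 d0, f4 * d0 - f1 * f2 * b0 = 1.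
  exists (- (u1 * u2)), (u1 * f1 * v2 + v1 * u2 * f2 + v1 * f4 * v2).
  by rewrite -[1](mulr1 1) -{1}e1 -e2; ring.
(* The matrix (1, f1 b0; f2, f4 d0) has determinant one; its inverse defines psi. *)
have [||||phi phiE phi_cls] :=
  @matrix_hom (f1 * f3 * f4) (f2 * f3) (f1 * f3) (f2 * f3 * f4)
    1 (f1 * b0) f2 (f4 * d0).
- by exists f4; ring.
- by exists (f2 * b0); ring.
- by exists f1; ring.
- by exists d0; ring.
have [||||psi _ psi_cls] :=
  @matrix_hom (f1 * f3) (f2 * f3 * f4) (f1 * f3 * f4) (f2 * f3)
    (f4 * d0) (- (f1 * b0)) (- f2) 1.
- by exists d0; ring.
- by exists (- (f2 * b0)); ring.
- by exists (- f1); ring.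
- by exists f4; ring.
have d0E : f4 * d0 = 1 + f1 * f2 * b0 by rewrite -bd; ring.
exists phi; split=> //; exists psi => -[z1 z2].
  have [x ->] := cls_surj z1; have [y ->] := cls_surj z2.
  by rewrite phi_cls psi_cls; congr pair; congr cls; rewrite d0E; ring.
have [x ->] := cls_surj z1; have [y ->] := cls_surj z2.
by rewrite psi_cls phi_cls; congr pair; congr cls; rewrite d0E; ring.
Qed.

Theorem theorem5p1 :
  (forall f g : {poly int},
     f \is monic -> g \is monic -> resultant f g != 0 ->
     ('H[f * g] ≅ 'H[f] ⊕ 'H[g] <-> `|resultant f g| = 1))
  /\
  (forall f1 f2 f3 f4 : {poly int},
     f1 \is monic -> f2 \is monic -> f3 \is monic -> f4 \is monic ->
     (forall i j : 'I_4, i != j ->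
        resultant [:: f1; f2; f3; f4]`_i [:: f1; f2; f3; f4]`_j != 0) ->
     ('H[f1 * f3 * f4] ⊕ 'H[f2 * f3] ≅ 'H[f1 * f3] ⊕ 'H[f2 * f3 * f4] <->
      `|resultant f1 f4| = 1 /\ `|resultant f2 f4| = 1)).
Proof.
have comax1 (h : {poly int}) : comaximal 1 h.
  by exists 1, 0; rewrite mul0r addr0 mulr1.
have comaxC (h k : {poly int}) : comaximal h k -> comaximal k h.
  by move=> [u [v E]]; exists v, u; rewrite addrC.
have nz (h k : {poly int}) : h \is monic -> k \is monic -> comaximal h k ->
    resultant h k != 0.
  move=> hM kM /(comaximal_resultant1 hM kM); rewrite -Num.Theory.normr_eq0 => ->.
  exact: oner_neq0.
have m1 := monic1 int.
split=> [f g fM gM _|f1 f2 f3 f4 f1M f2M f3M f4M r].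
  have [coprime_of_iso iso_of_coprime] := @endo_iso_comaximal f 1 1 g fM m1 m1
    (nz _ _ fM m1 (comaxC _ _ (comax1 f))) (nz _ _ m1 fM (comax1 f)).
  rewrite -comaximal_resultant1 //; rewrite !mulr1 !mul1r in coprime_of_iso iso_of_coprime.
  split=> [iso|fg].
    have := endo_iso_trans (endo_iso_sym (endo_iso_sum0 _)) iso.
    by move=> /coprime_of_iso[].
  exact: endo_iso_trans (endo_iso_sum0 _) (iso_of_coprime (conj fg (comax1 g))).
rewrite -!comaximal_resultant1 //; apply: endo_iso_comaximal => //.
  exact: (r (@Ordinal 4 0 isT) (@Ordinal 4 1 isT) isT).
exact: (r (@Ordinal 4 1 isT) (@Ordinal 4 0 isT) isT).
Qed.
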